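(* The Lorentzian grim-reaper $u=-e^{-2v}/2$, $v\in\mathbb{R}$ (resp. $u=e^{-2v}/2$, $v\in\mathbb{R}$), is the only spacelike (resp. timelike) curve, up to translations in the $u$-direction, in $\mathbb{L}^2$ with geometric linear momentum $\mathcal K(v)=-e^{-v}$ (resp. $\mathcal K(v)=e^{-v}$). That is: this curve, suitably parametrized by arc-length, is spacelike (resp. timelike) with $\mathcal K=-e^{-v}$ (resp. $\mathcal K=e^{-v}$); and every spacelike (resp. timelike) unit-speed curve in $\mathbb{L}^2$ with geometric linear momentum $\mathcal K(v)=-e^{-v}$ (resp. $\mathcal K(v)=e^{-v}$) is, up to a translation in the $u$-direction, an arc of it.
   Context: $\mathbb{L}^2=(\mathbb{R}^2,g=-dx^2+dy^2)$ is the Lorentz-Minkowski plane with rectangular coordinates $(x,y)$. A curve $\gamma=(x,y)$ is spacelike (resp. timelike) if $g(\gamma',\gamma')>0$ (resp. $<0$) everywhere. It is unit-speed if $g(\dot\gamma,\dot\gamma)=\epsilon$ with $\epsilon=1$ (spacelike) or $\epsilon=-1$ (timelike); the dot is the derivative with respect to the arc parameter $s$. Coordinates $(u,v)$ on $\mathbb{L}^2$ are defined by $u=y+x$, $v=y-x$, so that unit speed means $\dot u\,\dot v=\epsilon$. The geometric linear momentum (with respect to the lightlike geodesic $x=y$, the $u$-axis) of a unit-speed curve is $\mathcal K(s)=\dot u(s)$. ''Lorentzian grim-reaper'' is the name given to the curves $u=\mp e^{-2v}/2$, $v\in\mathbb{R}$. *)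

(* Defs.v *)
From Stdlib Require Import Reals Lra.
From Coquelicot Require Import Coquelicot.

Open Scope R_scope.

(** Points of the Lorentz-Minkowski plane are pairs [(x, y)] of rectangular
    coordinates; tangent vectors are pairs as well. *)
Definition L2 : Type := (R * R)%type.

Definition g (p q : L2) : R := - (fst p * fst q) + snd p * snd q.

Definition ucoord (p : L2) : R := snd p + fst p.
Definition vcoord (p : L2) : R := snd p - fst p.
Definition of_uv (u v : R) : L2 := ((u - v) / 2, (u + v) / 2).

Lemma ucoord_of_uv (u v : R) : ucoord (of_uv u v) = u.
Proof. unfold ucoord, of_uv; simpl; field. Qed.

Lemma vcoord_of_uv (u v : R) : vcoord (of_uv u v) = v.
Proof. unfold vcoord, of_uv; simpl; field. Qed.

Lemma of_uvK (p : L2) : of_uv (ucoord p) (vcoord p) = p.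
Proof.
  destruct p as [x y]; unfold of_uv, ucoord, vcoord; simpl.
  f_equal; field.
Qed.

Lemma g_uv (p : L2) : g p p = ucoord p * vcoord p.
Proof. unfold g, ucoord, vcoord; ring. Qed.

Definition translate_u (c : R) (p : L2) : L2 := of_uv (ucoord p + c) (vcoord p).

(** The open interval [(a, b)]; the ends may be infinite. *)
Definition in_itv (a b : Rbar) (t : R) : Prop := Rbar_lt a t /\ Rbar_lt t b.

Definition smooth_on (a b : Rbar) (f : R -> R) : Prop :=
  forall (n : nat) (t : R), in_itv a b t -> ex_derive_n f n t.

(** A curve is a map on all of [R], of which only the values on the parameter
    interval [(a, b)] are meaningful. *)
Definition differentiable_curve (a b : Rbar) (gam : R -> L2) : Prop :=
  forall t : R, in_itv a b t ->
    ex_derive (fun r => fst (gam r)) t /\ ex_derive (fun r => snd (gam r)) t.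

Definition smooth_curve (a b : Rbar) (gam : R -> L2) : Prop :=
  smooth_on a b (fun r => fst (gam r)) /\ smooth_on a b (fun r => snd (gam r)).

Definition velocity (gam : R -> L2) (t : R) : L2 :=
  (Derive (fun r => fst (gam r)) t, Derive (fun r => snd (gam r)) t).

Definition spacelike (a b : Rbar) (gam : R -> L2) : Prop :=
  forall t : R, in_itv a b t -> 0 < g (velocity gam t) (velocity gam t).

Definition timelike (a b : Rbar) (gam : R -> L2) : Prop :=
  forall t : R, in_itv a b t -> g (velocity gam t) (velocity gam t) < 0.

Definition unit_speed (eps : R) (a b : Rbar) (gam : R -> L2) : Prop :=
  forall s : R, in_itv a b s -> g (velocity gam s) (velocity gam s) = eps.

Definition spacelike_unit_speed_curve (a b : Rbar) (gam : R -> L2) : Prop :=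
  Rbar_lt a b /\ differentiable_curve a b gam /\
  spacelike a b gam /\ unit_speed 1 a b gam.

Definition timelike_unit_speed_curve (a b : Rbar) (gam : R -> L2) : Prop :=
  Rbar_lt a b /\ differentiable_curve a b gam /\
  timelike a b gam /\ unit_speed (-1) a b gam.

Definition momentum (gam : R -> L2) (s : R) : R :=
  Derive (fun r => ucoord (gam r)) s.

(** The momentum, prescribed as a function [k] of the coordinate [v]. *)
Definition has_momentum (a b : Rbar) (gam : R -> L2) (k : R -> R) : Prop :=
  forall s : R, in_itv a b s -> momentum gam s = k (vcoord (gam s)).

(** [gam] on [(a, b)] is [sig] on [(a', b')] composed with a smooth
    diffeomorphism [(a, b) -> (a', b')]. *)
Definition reparametrizes
    (a b : Rbar) (gam : R -> L2) (a' b' : Rbar) (sig : R -> L2) : Prop :=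
  exists phi : R -> R,
    smooth_on a b phi /\
    (forall s : R, in_itv a b s -> in_itv a' b' (phi s) /\ Derive phi s <> 0) /\
    (forall w : R, in_itv a' b' w -> exists! s : R, in_itv a b s /\ phi s = w) /\
    (forall s : R, in_itv a b s -> gam s = sig (phi s)).

(** The graphs [u = - e^(-2v) / 2] and [u = e^(-2v) / 2], parametrized by [v]. *)
Definition spacelike_grim_reaper (v : R) : L2 := of_uv (- exp (-2 * v) / 2) v.
Definition timelike_grim_reaper (v : R) : L2 := of_uv (exp (-2 * v) / 2) v.

(* Main.v *)
(** Unit speed [u' v' = eps] and [u' = - eps exp (- v)] give
    [(exp (- v))' = - v' exp (- v) = 1], so [exp (- v) = s + d] for a constant
    [d], and then [u' = - eps (s + d)] integrates to
    [u = - eps (s + d)^2 / 2 + c = - eps exp (- 2 v) / 2 + c].  With [eps = 1]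
    this is the spacelike curve, with [eps = -1] the timelike one. *)
Require Import Defs.
From Stdlib Require Import Reals Factorial Lra.
From Coquelicot Require Import Coquelicot.

Open Scope R_scope.

(** * Open intervals with possibly infinite ends *)

Lemma in_itv_open (a b : Rbar) (t : R) :
  in_itv a b t -> locally t (in_itv a b).
Proof.
  intros [Ha Hb].
  exact (filter_and _ _ (open_Rbar_gt' t a Ha) (open_Rbar_lt' t b Hb)).
Qed.

Lemma in_itv_convex (a b : Rbar) (s t r : R) :
  in_itv a b s -> in_itv a b t -> s <= r <= t -> in_itv a b r.
Proof.
  intros [Ha _] [_ Hb] [H1 H2]; split.
  - apply Rbar_lt_le_trans with s; assumption.
  - apply Rbar_le_lt_trans with t; assumption.
Qed.

Lemma in_itv_inhabited (a b : Rbar) :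
  Rbar_lt a b -> exists s : R, in_itv a b s.
Proof.
  unfold in_itv; destruct a as [a| |]; destruct b as [b| |]; simpl; intros H;
    try contradiction.
  - exists ((a + b) / 2); lra.
  - exists (a + 1); lra.
  - exists (b - 1); lra.
  - exists 0; tauto.
Qed.

Lemma is_derive_zero_const (a b : Rbar) (f : R -> R) (s t : R) :
  (forall r, in_itv a b r -> is_derive f r 0) ->
  in_itv a b s -> in_itv a b t -> f s = f t.
Proof.
  intros Hf Hs Ht.
  destruct (Rtotal_order s t) as [Hlt|[->|Hlt]]; [|reflexivity|symmetry].
  - apply (eq_is_derive f); [|exact Hlt].
    intros r Hr; apply Hf, (in_itv_convex a b s t); assumption.
  - apply (eq_is_derive f); [|exact Hlt].
    intros r Hr; apply Hf, (in_itv_convex a b t s); assumption.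
Qed.

(** * Smoothness of logarithms and polynomials on an interval *)

Lemma smooth_on_sequence (a b : Rbar) (h : nat -> R -> R) :
  (forall n t, in_itv a b t -> is_derive (h n) t (h (S n) t)) ->
  smooth_on a b (h 0%nat).
Proof.
  intros Hh.
  (* The iterated derivative is known to be [h n] only inside the interval; since the interval is
     open, this local agreement is enough to differentiate once more. *)
  assert (HD : forall n t, in_itv a b t -> Derive_n (h 0%nat) n t = h n t).
  { induction n as [|n IH]; intros t Ht; [reflexivity|]; simpl.
    rewrite (Derive_ext_loc _ (h n)).
    - apply is_derive_unique, Hh, Ht.
    - generalize (in_itv_open _ _ _ Ht); apply filter_imp; exact IH. }
  intros [|n] t Ht; simpl; [exact I|].
  apply (ex_derive_ext_loc (h n)).
  - generalize (in_itv_open _ _ _ Ht); apply filter_imp.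
    intros r Hr; symmetry; apply HD, Hr.
  - eexists; apply Hh, Ht.
Qed.

Lemma smooth_on_ln (a b : Rbar) (d : R) :
  (forall s, in_itv a b s -> 0 < s + d) ->
  smooth_on a b (fun s => ln (s + d)).
Proof.
  intros Hpos.
  apply (smooth_on_sequence a b (fun n s =>
    match n with
    | O => ln (s + d)
    | S m => (-1) ^ m * INR (fact m) * / (s + d) ^ S m
    end)).
  intros [|n] t Ht; pose proof (Hpos t Ht) as Hp.
  - auto_derive; [exact Hp|]; simpl; field; lra.
  - assert (Hn : (t + d) ^ n <> 0) by (apply pow_nonzero; lra).
    change (fact (S n)) with (S n * fact n)%nat; rewrite mult_INR.
    auto_derive.
    + apply (pow_nonzero (t + d) (S n)); lra.
    + rewrite S_INR; destruct n; simpl; [simpl in Hn; field; lra|].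
      simpl in Hn; field.
      split; [|lra]; intros H0; apply Hn; rewrite H0; ring.
Qed.

Lemma smooth_on_plus (a b : Rbar) (f h : R -> R) :
  smooth_on a b f -> smooth_on a b h -> smooth_on a b (fun s => f s + h s).
Proof.
  intros Hf Hh n t Ht.
  apply ex_derive_n_plus; generalize (in_itv_open _ _ _ Ht);
    apply filter_imp; intros r Hr k _; [apply Hf | apply Hh]; exact Hr.
Qed.

Lemma smooth_on_scal (a b : Rbar) (k : R) (f : R -> R) :
  smooth_on a b f -> smooth_on a b (fun s => k * f s).
Proof. intros Hf n t Ht; apply ex_derive_n_scal_l, Hf, Ht. Qed.

Lemma smooth_on_sqr (a b : Rbar) : smooth_on a b (fun s => s ^ 2).
Proof.
  apply (smooth_on_sequence a b (fun n s =>
    match n with O => s ^ 2 | 1%nat => 2 * s | 2%nat => 2 | _ => 0 end)).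
  intros [|[|[|n]]] t _; auto_derive; trivial; ring.
Qed.

Lemma smooth_on_ext (a b : Rbar) (f h : R -> R) :
  (forall s, f s = h s) -> smooth_on a b f -> smooth_on a b h.
Proof. intros E Hf n t Ht; apply (ex_derive_n_ext f); auto. Qed.

(** * The change of parameter v = - ln (s + d) *)

(** The decreasing extension of [s |-> - ln (s + d)] to the extended line. *)
Definition neg_ln_Rbar (d : R) (r : Rbar) : Rbar :=
  match r with
  | Finite x => if Rlt_dec 0 (x + d) then Finite (- ln (x + d)) else p_infty
  | p_infty => m_infty
  | m_infty => p_infty
  end.

Lemma neg_ln_lt_iff (x y : R) :
  0 < x -> 0 < y -> (- ln x < - ln y <-> y < x).
Proof.
  intros Hx Hy; split; intros H.
  - apply ln_lt_inv; lra.
  - apply Ropp_lt_contravar, ln_increasing; assumption.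
Qed.

(** The map is decreasing, so the two ends swap. An end x with x + d <= 0 is sent to [p_infty]: as a
    left end it bounds nothing on either side, because s + d > 0, and as a right end it makes both
    intervals miss the point. *)
Lemma in_itv_neg_ln (a b : Rbar) (d s : R) :
  0 < s + d ->
  (in_itv (neg_ln_Rbar d b) (neg_ln_Rbar d a) (- ln (s + d)) <-> in_itv a b s).
Proof.
  intros Hs; unfold in_itv.
  assert (Ha : Rbar_lt (- ln (s + d)) (neg_ln_Rbar d a) <-> Rbar_lt a s).
  { destruct a as [a| |]; simpl; try tauto.
    destruct (Rlt_dec 0 (a + d)) as [Hd|Hd]; simpl.
    - rewrite neg_ln_lt_iff by assumption; lra.
    - split; [lra|tauto]. }
  assert (Hb : Rbar_lt (neg_ln_Rbar d b) (- ln (s + d)) <-> Rbar_lt s b).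
  { destruct b as [b| |]; simpl; try tauto.
    destruct (Rlt_dec 0 (b + d)) as [Hd|Hd]; simpl.
    - rewrite neg_ln_lt_iff by assumption; lra.
    - split; [tauto|lra]. }
  tauto.
Qed.

(** Serves both directions of the theorem: the explicit curve, with d = 0, and an arbitrary
    solution, with d its constant of integration. *)
Lemma reparametrizes_neg_ln (a b : Rbar) (d : R) (gam sig : R -> L2) :
  (forall s, in_itv a b s -> 0 < s + d) ->
  (forall s, in_itv a b s -> gam s = sig (- ln (s + d))) ->
  reparametrizes a b gam (neg_ln_Rbar d b) (neg_ln_Rbar d a) sig.
Proof.
  intros Hpos Hgam; exists (fun s => - ln (s + d)).
  split; [|split; [|split]].
  - apply smooth_on_ext with (fun s => -1 * ln (s + d)); [intros s; ring|].
    apply smooth_on_scal, smooth_on_ln, Hpos.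
  - intros s Hs; pose proof (Hpos s Hs) as Hp; split.
    + apply in_itv_neg_ln; assumption.
    + rewrite (is_derive_unique _ s (- / (s + d))).
      * apply Ropp_neq_0_compat, Rinv_neq_0_compat; lra.
      * auto_derive; [exact Hp|field; lra].
  - intros w Hw.
    (* The preimage of w is exp (- w) - d, the solution of - ln (s + d) = w. *)
    assert (Hp : 0 < exp (- w) - d + d) by (pose proof (exp_pos (- w)); lra).
    assert (Ew : - ln (exp (- w) - d + d) = w).
    { replace (exp (- w) - d + d) with (exp (- w)) by ring.
      rewrite ln_exp; ring. }
    exists (exp (- w) - d); split.
    + split; [|exact Ew].
      apply (in_itv_neg_ln a b d); [exact Hp|]; rewrite Ew; exact Hw.
    + intros s [Hs <-]; rewrite Ropp_involutive, exp_ln by auto; ring.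
  - exact Hgam.
Qed.

Lemma neg_ln_Rbar_lt (a b : Rbar) (d : R) :
  Rbar_lt a b -> (forall s, in_itv a b s -> 0 < s + d) ->
  Rbar_lt (neg_ln_Rbar d b) (neg_ln_Rbar d a).
Proof.
  intros Hab Hpos; destruct (in_itv_inhabited a b Hab) as [s Hs].
  destruct (proj2 (in_itv_neg_ln a b d s (Hpos s Hs)) Hs) as [H1 H2].
  exact (Rbar_lt_trans _ _ _ H1 H2).
Qed.

(** * Integration of the momentum equation *)

Lemma exp_m2_neg_ln (x : R) : 0 < x -> exp (-2 * - ln x) = x ^ 2.
Proof.
  intros Hx; replace (-2 * - ln x) with (ln x + ln x) by ring.
  rewrite exp_plus, exp_ln by exact Hx; ring.
Qed.

(** Both signs are treated at once. The equations are integrated through two conserved quantities,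
    exp (- v) - s and then u + eps (s + d)^2 / 2, so only first derivatives of the curve enter. *)
Lemma unit_speed_momentum_solution (eps : R) (a b : Rbar) (gam : R -> L2) :
  eps <> 0 -> Rbar_lt a b -> differentiable_curve a b gam ->
  unit_speed eps a b gam ->
  has_momentum a b gam (fun v => - eps * exp (- v)) ->
  exists c d : R, forall s, in_itv a b s ->
    0 < s + d /\ gam s = of_uv (- eps * (s + d) ^ 2 / 2 + c) (- ln (s + d)).
Proof.
  intros Heps Hab Hdiff Hunit Hmom.
  set (u := fun r => ucoord (gam r)); set (v := fun r => vcoord (gam r)).
  assert (Hu : forall s, in_itv a b s -> is_derive u s (- eps * exp (- v s))).
  { intros s Hs; unfold v; rewrite <- (Hmom s Hs); apply Derive_correct.
    destruct (Hdiff s Hs).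
    apply (ex_derive_plus (fun r => snd (gam r))); assumption. }
  assert (Hv : forall s, in_itv a b s -> is_derive v s (- exp (v s))).
  { intros s Hs; destruct (Hdiff s Hs) as [Hx Hy].
    pose proof (Hunit s Hs) as Hg; rewrite g_uv in Hg.
    assert (Eu : ucoord (velocity gam s) = - eps * exp (- v s)).
    { rewrite <- (is_derive_unique _ _ _ (Hu s Hs)); symmetry.
      apply (Derive_plus (fun r => snd (gam r))); assumption. }
    assert (Ev : vcoord (velocity gam s) = - exp (v s)).
    { rewrite Eu, exp_Ropp in Hg; pose proof (exp_pos (v s)) as He.
      (* Cancel u' = - eps exp (- v) in u' v' = eps; it is nonzero because eps is. *)
      apply (Rmult_eq_reg_l (- eps * / exp (v s))).
      - rewrite Hg; field; lra.
      - apply Rmult_integral_contrapositive_currified;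
          [lra | apply Rinv_neq_0_compat; lra]. }
    rewrite <- Ev.
    apply (is_derive_minus (fun r => snd (gam r)) (fun r => fst (gam r)));
      apply Derive_correct; assumption. }
  destruct (in_itv_inhabited a b Hab) as [s0 Hs0].
  (* The value of the first conserved quantity at a base point. *)
  set (d := exp (- v s0) - s0).
  assert (Hd : forall s, in_itv a b s -> exp (- v s) = s + d).
  { intros s Hs.
    enough (exp (- v s) - s = exp (- v s0) - s0) by (unfold d; lra).
    apply (is_derive_zero_const a b (fun r => exp (- v r) - r));
      [|assumption|assumption].
    intros r Hr; pose proof (Hv r Hr) as Hvr.
    auto_derive; [eexists; exact Hvr|].
    change (fun x => v x) with v; rewrite (is_derive_unique _ _ _ Hvr), exp_Ropp.
    field; pose proof (exp_pos (v r)); lra. }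
  (* The value at the base point of the second conserved quantity, whose derivative - eps exp (- v)
     + eps (s + d) vanishes by [Hd]. *)
  set (c := u s0 + eps * (s0 + d) ^ 2 / 2).
  exists c, d; intros s Hs; split.
  - rewrite <- (Hd s Hs); apply exp_pos.
  - rewrite <- (of_uvK (gam s)); f_equal.
    + enough (u s + eps * (s + d) ^ 2 / 2 = u s0 + eps * (s0 + d) ^ 2 / 2)
        by (unfold c; fold (u s); lra).
      apply (is_derive_zero_const a b (fun r => u r + eps * (r + d) ^ 2 / 2));
        [|assumption|assumption].
      intros r Hr; pose proof (Hu r Hr) as Hur.
      auto_derive; [eexists; exact Hur|].
      change (fun x => u x) with u; rewrite (is_derive_unique _ _ _ Hur), (Hd r Hr).
      field.
    + rewrite <- (Hd s Hs), ln_exp; unfold v; ring.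
Qed.

(** * The grim-reaper parametrized by arc length *)

Definition arc_length_grim_reaper (eps s : R) : L2 :=
  of_uv (- eps * s ^ 2 / 2) (- ln s).

Lemma velocity_arc_length_grim_reaper (eps s : R) :
  0 < s -> velocity (arc_length_grim_reaper eps) s = of_uv (- eps * s) (- / s).
Proof.
  intros Hs; unfold velocity, arc_length_grim_reaper, of_uv; simpl.
  f_equal; apply is_derive_unique; auto_derive; try exact Hs; field; lra.
Qed.

(** Both rectangular coordinates are linear combinations of s^2 and ln s. *)
Lemma arc_length_grim_reaper_smooth (eps : R) :
  smooth_curve 0 p_infty (arc_length_grim_reaper eps).
Proof.
  assert (Hln : smooth_on 0 p_infty (fun s => ln (s + 0))).
  { apply smooth_on_ln; intros s [Hs _]; simpl in Hs; lra. }
  split.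
  - apply smooth_on_ext with (fun s => - eps / 4 * s ^ 2 + / 2 * ln (s + 0)).
    + intros s; rewrite Rplus_0_r; simpl; field.
    + apply smooth_on_plus; apply smooth_on_scal; [apply smooth_on_sqr|exact Hln].
  - apply smooth_on_ext with (fun s => - eps / 4 * s ^ 2 + - / 2 * ln (s + 0)).
    + intros s; rewrite Rplus_0_r; simpl; field.
    + apply smooth_on_plus; apply smooth_on_scal; [apply smooth_on_sqr|exact Hln].
Qed.

Lemma smooth_curve_differentiable (a b : Rbar) (gam : R -> L2) :
  smooth_curve a b gam -> differentiable_curve a b gam.
Proof. intros [Hx Hy] t Ht; split; [apply (Hx 1%nat)|apply (Hy 1%nat)]; exact Ht. Qed.

Lemma arc_length_grim_reaper_unit_speed (eps : R) :
  unit_speed eps 0 p_infty (arc_length_grim_reaper eps).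
Proof.
  intros s [Hs _]; simpl in Hs.
  rewrite velocity_arc_length_grim_reaper by exact Hs.
  rewrite g_uv, ucoord_of_uv, vcoord_of_uv; field; lra.
Qed.

Lemma arc_length_grim_reaper_momentum (eps : R) :
  has_momentum 0 p_infty (arc_length_grim_reaper eps)
    (fun v => - eps * exp (- v)).
Proof.
  intros s [Hs _]; simpl in Hs; unfold momentum.
  rewrite (Derive_ext _ (fun r => - eps * r ^ 2 / 2))
    by (intros r; apply ucoord_of_uv).
  unfold arc_length_grim_reaper.
  rewrite vcoord_of_uv, Ropp_involutive, exp_ln by exact Hs.
  apply is_derive_unique; auto_derive; trivial; field.
Qed.

(** As s runs over the positive half-line, v = - ln s covers the whole line, so the entire graph is
    reached and not just an arc. *)
Lemma arc_length_grim_reaper_reparametrizes (eps : R) (sig : R -> L2) :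
  (forall v, sig v = of_uv (- eps * exp (-2 * v) / 2) v) ->
  reparametrizes 0 p_infty (arc_length_grim_reaper eps) m_infty p_infty sig.
Proof.
  intros Hsig.
  (* The end s = 0 corresponds to v = [p_infty], since 0 + 0 is not positive. *)
  replace p_infty with (neg_ln_Rbar 0 0) at 2
    by (simpl; destruct (Rlt_dec 0 (0 + 0)); [lra|reflexivity]).
  change m_infty with (neg_ln_Rbar 0 p_infty).
  apply reparametrizes_neg_ln; intros s [Hs _]; simpl in Hs; [lra|].
  rewrite Hsig, exp_m2_neg_ln by lra.
  unfold arc_length_grim_reaper; rewrite Rplus_0_r; reflexivity.
Qed.

(** The constant c from integrating u is the translation; the constant d is absorbed by the change
    of parameter, and the arc lies over the image of (a, b) under - ln (s + d). *)
Lemma momentum_grim_reaper_arc (eps : R) (a b : Rbar) (gam sig : R -> L2) :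
  eps <> 0 -> (forall v, sig v = of_uv (- eps * exp (-2 * v) / 2) v) ->
  Rbar_lt a b -> differentiable_curve a b gam -> unit_speed eps a b gam ->
  has_momentum a b gam (fun v => - eps * exp (- v)) ->
  exists (c : R) (a' b' : Rbar), Rbar_lt a' b' /\
    reparametrizes a b gam a' b' (fun v => translate_u c (sig v)).
Proof.
  intros Heps Hsig Hab Hdiff Hunit Hmom.
  destruct (unit_speed_momentum_solution eps a b gam Heps Hab Hdiff Hunit Hmom)
    as (c & d & Hsol).
  exists c, (neg_ln_Rbar d b), (neg_ln_Rbar d a); split.
  - apply neg_ln_Rbar_lt; [exact Hab|]; intros s Hs; apply Hsol, Hs.
  - apply reparametrizes_neg_ln; intros s Hs; destruct (Hsol s Hs) as [Hp E];
      [exact Hp|].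
    unfold translate_u; rewrite Hsig, ucoord_of_uv, vcoord_of_uv.
    rewrite exp_m2_neg_ln by exact Hp; exact E.
Qed.

Theorem corollary8p1 :
  ((exists (a b : Rbar) (gam : R -> L2),
      spacelike_unit_speed_curve a b gam /\ smooth_curve a b gam /\
      has_momentum a b gam (fun v => - exp (- v)) /\
      reparametrizes a b gam m_infty p_infty spacelike_grim_reaper) /\
   (forall (a b : Rbar) (gam : R -> L2),
      spacelike_unit_speed_curve a b gam ->
      has_momentum a b gam (fun v => - exp (- v)) ->
      exists (c : R) (a' b' : Rbar), Rbar_lt a' b' /\
        reparametrizes a b gam a' b'
          (fun v => translate_u c (spacelike_grim_reaper v)))) /\
  ((exists (a b : Rbar) (gam : R -> L2),
      timelike_unit_speed_curve a b gam /\ smooth_curve a b gam /\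
      has_momentum a b gam (fun v => exp (- v)) /\
      reparametrizes a b gam m_infty p_infty timelike_grim_reaper) /\
   (forall (a b : Rbar) (gam : R -> L2),
      timelike_unit_speed_curve a b gam ->
      has_momentum a b gam (fun v => exp (- v)) ->
      exists (c : R) (a' b' : Rbar), Rbar_lt a' b' /\
        reparametrizes a b gam a' b'
          (fun v => translate_u c (timelike_grim_reaper v)))).
Proof.
  (* The two graphs are the cases eps = 1 and eps = -1 of one formula. *)
  assert (Hs : forall v, spacelike_grim_reaper v
                         = of_uv (- 1 * exp (-2 * v) / 2) v)
    by (intros v; unfold spacelike_grim_reaper; f_equal; field).
  assert (Ht : forall v, timelike_grim_reaper v
                         = of_uv (- -1 * exp (-2 * v) / 2) v)
    by (intros v; unfold timelike_grim_reaper; f_equal; field).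
  split; split.
  - exists (Finite 0), p_infty, (arc_length_grim_reaper 1).
    pose proof (arc_length_grim_reaper_smooth 1) as Hsm.
    pose proof (arc_length_grim_reaper_unit_speed 1) as Hun.
    repeat split; try apply Hsm; try exact Hun.
    + apply smooth_curve_differentiable with (1 := Hsm); assumption.
    + apply smooth_curve_differentiable with (1 := Hsm); assumption.
    + intros s H; rewrite (Hun s H); lra.
    + intros s H; rewrite (arc_length_grim_reaper_momentum 1 s H); ring.
    + apply arc_length_grim_reaper_reparametrizes, Hs.
  - intros a b gam (Hab & Hdiff & _ & Hun) Hmom.
    apply (momentum_grim_reaper_arc 1); try assumption; [lra|].
    intros s H; rewrite (Hmom s H); ring.
  - exists (Finite 0), p_infty, (arc_length_grim_reaper (-1)).
    pose proof (arc_length_grim_reaper_smooth (-1)) as Hsm.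
    pose proof (arc_length_grim_reaper_unit_speed (-1)) as Hun.
    repeat split; try apply Hsm; try exact Hun.
    + apply smooth_curve_differentiable with (1 := Hsm); assumption.
    + apply smooth_curve_differentiable with (1 := Hsm); assumption.
    + intros s H; rewrite (Hun s H); lra.
    + intros s H; rewrite (arc_length_grim_reaper_momentum (-1) s H); ring.
    + apply arc_length_grim_reaper_reparametrizes, Ht.
  - intros a b gam (Hab & Hdiff & _ & Hun) Hmom.
    apply (momentum_grim_reaper_arc (-1)); try assumption; [lra|].
    intros s H; rewrite (Hmom s H); ring.
Qed.
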